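(* Let $X$ be a metric space, let $r > 0$, and let $p_1, p_2 : X \times X \to X$ be the projection maps $p_1(x_1,x_2) = x_1$ and $p_2(x_1,x_2) = x_2$. Then $\mathrm{TC}_r(X) = D^{(1)}_r(p_1, p_2)$.
   Context: For a non-negative integer $m$, $[m] = \{0, 1, \dots, m\}$ carries the metric $d(a,b) = |a-b|$. Products of metric spaces carry the $\ell^1$-metric. For $s \ge 0$, a map $\varphi$ between metric spaces is $s$-Lipschitz if $d(\varphi(x), \varphi(x')) \le s\, d(x,x')$ for all $x,x'$. For maps $f, g : X \to Y$ between metric spaces, an $(s,r)$-homotopy between $f$ and $g$ is a map $F : X \times [m] \to Y$, for some non-negative integer $m$, such that (1) $F(x,-) : [m] \to Y$ is $r$-Lipschitz for every $x \in X$; (2) $F(-,i) : X \to Y$ is $s$-Lipschitz for every $i \in [m]$; (3) $F(x,0) = f(x)$ and $F(x,m) = g(x)$ for all $x \in X$. One writes $f \simeq_{(s,r)} g$ if such an $F$ exists. For two $s$-Lipschitz maps $f,g : X \to Y$, the discrete homotopic distance $D^{(s)}_r(f,g)$ is the smallest integer $k \ge 0$ for which there is an open cover $U_0, \dots, U_k$ of $X$ with $f|_{U_i} \simeq_{(s,r)} g|_{U_i}$ (as maps $U_i \to Y$) for all $i = 0, \dots, k$; it is $\infty$ if no such cover exists. An $r$-path in $X$ is a map $\gamma : [m] \to X$ with $d(\gamma(i), \gamma(i+1)) \le r$ for all $0 \le i < m$. $X^{[m]}$ denotes the set of $r$-paths $\gamma : [m] \to X$ with the uniform metric $d(\gamma,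 \gamma') = \max_{j \in [m]} d_X(\gamma(j), \gamma'(j))$, and $\pi : X^{[m]} \to X \times X$ is $\pi(\gamma) = (\gamma(0), \gamma(m))$. The discrete topological complexity $\mathrm{TC}_r(X)$ is the smallest integer $k \ge 0$ such that $X \times X = U_0 \cup \dots \cup U_k$ with each $U_i$ open and, for each $i$, there are an integer $m \ge 0$ (possibly depending on $i$) and a $1$-Lipschitz map $S_i : U_i \to X^{[m]}$ with $\pi \circ S_i = \mathrm{id}_{U_i}$ (i.e. $\pi(S_i(u)) = u$ for all $u \in U_i$); $\mathrm{TC}_r(X) = \infty$ if no such $k$ exists. *)

(* Defs.v *)
From HB Require Import structures.
From mathcomp Require Import all_boot all_order all_algebra.
From mathcomp Require Import mathcomp_extra boolp classical_sets reals.
From mathcomp Require Import topology.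

Set Implicit Arguments.
Unset Strict Implicit.
Unset Printing Implicit Defensive.

Import Order.TTheory GRing.Theory Num.Theory.

Local Open Scope classical_set_scope.
Local Open Scope ring_scope.

(* The library metrizes no subsets or ordinals, and gives products the topology
   of the sup metric; hence the aliases below, each with its own metric. *)

Definition l1prod (R : realType) (X Y : metricType R) : Type := (X * Y)%type.

Section L1Prod.
Context (R : realType) (X Y : metricType R).

HB.instance Definition _ := Choice.copy (l1prod X Y) (X * Y)%type.

Definition l1dist (z t : l1prod X Y) : R := mdist z.1 t.1 + mdist z.2 t.2.

Lemma l1distxx z : l1dist z z = 0.
Proof. by rewrite /l1dist !mdistxx addr0. Qed.

Lemma l1dist_positivity z t : l1dist z t = 0 -> z = t.
Proof.
move=> /eqP; rewrite paddr_eq0 ?mdist_ge0// => /andP[/eqP e1 /eqP e2].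
case: z t e1 e2 => [z1 z2] [t1 t2] /= e1 e2.
by rewrite (mdist_positivity _ _ e1) (mdist_positivity _ _ e2).
Qed.

Lemma l1dist_sym z t : l1dist z t = l1dist t z.
Proof. by rewrite /l1dist (metric_sym z.1) (metric_sym z.2). Qed.

Lemma l1dist_triangle t z u : l1dist z u <= l1dist z t + l1dist t u.
Proof. by rewrite /l1dist addrACA lerD ?metric_triangle. Qed.

HB.instance Definition _ := isMetric.Build R (l1prod X Y)
  l1distxx l1dist_positivity l1dist_sym l1dist_triangle.

Definition l1fst (z : l1prod X Y) : X := z.1.
Definition l1snd (z : l1prod X Y) : Y := z.2.

End L1Prod.

Definition submetric (R : realType) (X : metricType R) (U : set X) : Type :=
  set_type U.

Section SubMetric.
Context (R : realType) (X : metricType R) (U : set X).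

HB.instance Definition _ := Choice.copy (submetric U) (set_type U).

Definition incl (u : submetric U) : X := sval u.

Definition subdist (u v : submetric U) : R := mdist (incl u) (incl v).

Lemma subdistxx u : subdist u u = 0.
Proof. exact: mdistxx. Qed.

Lemma subdist_positivity u v : subdist u v = 0 -> u = v.
Proof. by move=> /mdist_positivity /val_inj. Qed.

Lemma subdist_sym u v : subdist u v = subdist v u.
Proof. exact: metric_sym. Qed.

Lemma subdist_triangle v u w : subdist u w <= subdist u v + subdist v w.
Proof. exact: metric_triangle. Qed.

HB.instance Definition _ := isMetric.Build R (submetric U)
  subdistxx subdist_positivity subdist_sym subdist_triangle.

End SubMetric.

(* [m] = {0, ..., m}, which has m + 1 elements *)
Definition dint (R : realType) (m : nat) : Type := 'I_m.+1.

Section DInt.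
Context (R : realType) (m : nat).

HB.instance Definition _ := Choice.copy (dint R m) (ordinal m.+1).

Definition dint_val (a : dint R m) : nat := nat_of_ord a.
Definition dint_first : dint R m := ord0.
Definition dint_last : dint R m := ord_max.

Definition dintdist (a b : dint R m) : R :=
  `|(dint_val a)%:R - (dint_val b)%:R|.

Lemma dintdistxx a : dintdist a a = 0.
Proof. by rewrite /dintdist subrr normr0. Qed.

Lemma dintdist_positivity a b : dintdist a b = 0 -> a = b.
Proof.
by move=> /eqP; rewrite normr_eq0 subr_eq0 eqr_nat => /eqP /val_inj.
Qed.

Lemma dintdist_sym a b : dintdist a b = dintdist b a.
Proof. exact: distrC. Qed.

Lemma dintdist_triangle b a c : dintdist a c <= dintdist a b + dintdist b c.
Proof. exact: ler_distD. Qed.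

HB.instance Definition _ := isMetric.Build R (dint R m)
  dintdistxx dintdist_positivity dintdist_sym dintdist_triangle.

End DInt.

Definition is_rpath (R : realType) (X : metricType R) (r : R) (m : nat)
    (gamma : dint R m -> X) : Prop :=
  forall i j : dint R m, dint_val j = (dint_val i).+1 ->
    mdist (gamma i) (gamma j) <= r.

Definition rpath (R : realType) (X : metricType R) (r : R) (m : nat) : Type :=
  set_type [set gamma : dint R m -> X | is_rpath r gamma].

Section RPath.
Context (R : realType) (X : metricType R) (r : R) (m : nat).

HB.instance Definition _ := Choice.copy (rpath X r m)
  (set_type [set gamma : dint R m -> X | is_rpath r gamma]).

Definition rpath_fun (gamma : rpath X r m) : dint R m -> X := sval gamma.

(* distances are nonnegative and [m] is nonempty, so the default value 0 of the
   iterated maximum is harmless *)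
Definition rpathdist (gamma delta : rpath X r m) : R :=
  \big[Num.max/0]_(j < m.+1) mdist (rpath_fun gamma j) (rpath_fun delta j).

Lemma rpathdistxx gamma : rpathdist gamma gamma = 0.
Proof.
rewrite /rpathdist; elim/big_ind: _ => // [x y -> ->|i _].
  exact: maxxx.
exact: mdistxx.
Qed.

Lemma ler_rpathdist gamma delta j :
  mdist (rpath_fun gamma j) (rpath_fun delta j) <= rpathdist gamma delta.
Proof. by rewrite /rpathdist; apply: le_bigmax_cond. Qed.

Lemma rpathdist_positivity gamma delta :
  rpathdist gamma delta = 0 -> gamma = delta.
Proof.
move=> e; apply: val_inj; apply/funext => j; apply: mdist_positivity.
by apply/eqP; rewrite eq_le mdist_ge0 andbT -e ler_rpathdist.
Qed.

Lemma rpathdist_sym gamma delta : rpathdist gamma delta = rpathdist delta gamma.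
Proof. by apply: eq_bigr => j _; apply: metric_sym. Qed.

Lemma rpathdist_triangle delta gamma eps :
  rpathdist gamma eps <= rpathdist gamma delta + rpathdist delta eps.
Proof.
apply: bigmax_le => [|j _].
  by rewrite addr_ge0// (le_trans (mdist_ge0 _ _) (ler_rpathdist _ _ ord0)).
by rewrite (le_trans (metric_triangle _ (rpath_fun delta j) _))// lerD
  ?ler_rpathdist.
Qed.

HB.instance Definition _ := isMetric.Build R (rpath X r m)
  rpathdistxx rpathdist_positivity rpathdist_sym rpathdist_triangle.

Definition endpoints (gamma : rpath X r m) : l1prod X X :=
  (rpath_fun gamma (dint_first R m), rpath_fun gamma (dint_last R m)).

End RPath.

Definition lipschitz_map (R : realType) (X Y : metricType R) (s : R)
    (phi : X -> Y) : Prop :=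
  forall x x' : X, mdist (phi x) (phi x') <= s * mdist x x'.

Definition homotopic (R : realType) (X Y : metricType R) (s r : R)
    (f g : X -> Y) : Prop :=
  exists (m : nat) (F : X * dint R m -> Y),
    [/\ forall x : X, lipschitz_map r (fun i : dint R m => F (x, i)),
        forall i : dint R m, lipschitz_map s (fun x : X => F (x, i)),
        forall x : X, F (x, dint_first R m) = f x
      & forall x : X, F (x, dint_last R m) = g x].

(* Least element of a set of natural numbers; None stands for infinity. *)
Definition least (P : set nat) : option nat :=
  if pselect (exists k, `[< P k >]) is left h then Some (ex_minn h) else None.

Definition open_cover (T : topologicalType) (k : nat) (U : 'I_k.+1 -> set T) :
    Prop :=
  (forall i, open (U i)) /\ \bigcup_i U i = [set: T].

(* D^(s)_r(f, g); only meaningful when f and g are s-Lipschitz. *)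
Definition homotopic_distance (R : realType) (X Y : metricType R) (s r : R)
    (f g : X -> Y) : option nat :=
  least [set k | exists U : 'I_k.+1 -> set X, open_cover U /\
    forall i, homotopic s r (fun u : submetric (U i) => f (incl u))
                            (fun u : submetric (U i) => g (incl u))].

Definition TC (R : realType) (r : R) (X : metricType R) : option nat :=
  least [set k | exists U : 'I_k.+1 -> set (l1prod X X), open_cover U /\
    forall i, exists (m : nat) (S : submetric (U i) -> rpath X r m),
      lipschitz_map 1 S /\ forall u, endpoints (S u) = incl u].

Lemma l1fst_lipschitz (R : realType) (X Y : metricType R) :
  lipschitz_map 1 (@l1fst R X Y).
Proof. by move=> z t; rewrite mul1r /mdist/= lerDl mdist_ge0. Qed.

Lemma l1snd_lipschitz (R : realType) (X Y : metricType R) :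
  lipschitz_map 1 (@l1snd R X Y).
Proof. by move=> z t; rewrite mul1r /mdist/= lerDr mdist_ge0. Qed.

(* Main.v *)
Require Import Defs.
From mathcomp Require Import all_boot all_order all_algebra.
From mathcomp Require Import reals topology.
From mathcomp Require Import boolp classical_sets.

Import Order.TTheory GRing.Theory Num.Theory.

Local Open Scope ring_scope.

(** Both invariants minimise over the same open covers, so it suffices to fix a
    piece [U] of the product and to see that planning motions on [U] and
    deforming the first projection into the second one over [U] are the same
    datum, by currying. A family of paths [S u] indexed by [u] in [U] is a map
    [F (u, i) = S u i] of two variables. Being an r-path in the variable [i] is
    the same as being r-Lipschitz in [i], since consecutive steps chain by the
    triangle inequality ([is_rpath_lipschitz]). As paths carry the uniform
    metric, [S] is 1-Lipschitz exactly when each [F (_, i)] is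
    ([rpath_dist_le]). Finally, prescribing the endpoints of [S u] to be the
    coordinates of [u] prescribes the two ends of the homotopy
    ([motion_planner_homotopic]). *)

(** Distances in [[m]] count steps, so bounding each step by [r] bounds a
    displacement from [i] to [j] by [r * (j - i)]. *)
Lemma is_rpath_lipschitz (R : realType) (X : metricType R) (r : R) (m : nat)
    (gamma : dint R m -> X) :
  is_rpath r gamma <-> lipschitz_map r gamma.
Proof.
split=> [step|lip i j ij]; last first.
  have := lip i j.
  by rewrite [mdist i j]/(dintdist _ _) /dintdist ij -natr1 opprD addNKr normrN1
    mulr1.
have chain (n : nat) (i j : dint R m) : dint_val j = (dint_val i + n)%N ->
    mdist (gamma i) (gamma j) <= r * n%:R.
  elim: n j => [|n IHn] j.
    by rewrite addn0 => /val_inj ->; rewrite mdistxx mulr0.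
  rewrite addnS => jE.
  have ltkm : (dint_val i + n < m.+1)%N.
    by rewrite ltnW// -jE ltn_ord.
  pose k : dint R m := Ordinal ltkm.
  rewrite (le_trans (metric_triangle _ (gamma k) _))// -natr1 mulrDr mulr1.
  by rewrite lerD ?IHn ?step.
have ordered (i j : dint R m) : (dint_val i <= dint_val j)%N ->
    mdist (gamma i) (gamma j) <= r * mdist i j.
  move=> leij; have jE := esym (subnKC leij).
  rewrite (le_trans (chain _ _ _ jE))// [mdist i j]/(dintdist _ _) /dintdist.
  by rewrite distrC -natrB// normr_nat.
move=> i j; case/orP: (leq_total (dint_val i) (dint_val j)) => [|le_ji].
  exact: ordered.
by rewrite metric_sym [mdist i j]metric_sym ordered.
Qed.

Lemma rpath_dist_le {R : realType} {X : metricType R} {r : R} {m : nat}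
    (gamma delta : rpath X r m) (c : R) : 0 <= c ->
  mdist gamma delta <= c <->
  forall i, mdist (rpath_fun gamma i) (rpath_fun delta i) <= c.
Proof.
move=> c0; split=> [le_c i|le_c].
  exact: le_trans (ler_rpathdist _ _ _) le_c.
by apply: bigmax_le.
Qed.

(** Currying: the section [S] corresponds to the homotopy [F (u, i) = S u i]. *)
Lemma motion_planner_homotopic (R : realType) (X : metricType R) (r : R)
    (U : set (l1prod X X)) :
  (exists (m : nat) (S : submetric U -> rpath X r m),
     lipschitz_map 1 S /\ forall u, endpoints (S u) = incl u) <->
  homotopic 1 r (fun u : submetric U => l1fst (incl u))
                (fun u : submetric U => l1snd (incl u)).
Proof.
split=> [[m [S [lipS endS]]]|[m [F [lipFu lipFi F0 Fm]]]]; exists m.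
  exists (fun ui => rpath_fun (S ui.1) ui.2); split=> [u|i u v|u|u] /=.
  - by apply/is_rpath_lipschitz; exact: set_valP (S u).
  - by apply: (rpath_dist_le _ _ _ _).1 (lipS u v) i; rewrite mul1r mdist_ge0.
  - by rewrite -endS.
  - by rewrite -endS.
have rpathF u : is_rpath r (fun i => F (u, i)) by apply/is_rpath_lipschitz.
pose S u : rpath X r m :=
  exist (fun gamma => gamma \in [set gamma | is_rpath r gamma]%classic)
    (fun i => F (u, i)) (mem_set (rpathF u)).
exists S; split=> [u v|u].
  apply/rpath_dist_le => [|i]; first by rewrite mul1r mdist_ge0.
  exact: lipFi.
by rewrite /endpoints /rpath_fun /= F0 Fm; case: (incl u).
Qed.

Theorem proposition3p4 (R : realType) (X : metricType R) (r : R) (hr : 0 < r) :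
  TC r X = homotopic_distance 1 r (@l1fst R X X) (@l1snd R X X).
Proof.
congr least; apply/seteqP; split=> k [U [covU HU]]; exists U; split=> // i;
  exact/motion_planner_homotopic.
Qed.
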